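(* Let $(X,Z,M_1,M_0,Y_1,Y_0)$ be random variables with $X\in\mathbb{X}\subseteq\mathbb{R}^{d_X}$, $Z\in\{0,1\}$, $M_1,M_0\in\mathbb{R}$, $Y_1,Y_0\in\mathbb{R}$, and set $M=ZM_1+(1-Z)M_0$, $Y=ZY_1+(1-Z)Y_0$, $U=(M_1,M_0)$. Suppose (A1) $Z\perp\!\!\!\perp (M_0,M_1,Y_0,Y_1)\mid X$; (A2) $\mathbb{E}(Y_z\mid X,U=u)=\mathbb{E}(Y_z\mid X,M_z=m_z)$ for every $z\in\{0,1\}$ and every $u=(m_1,m_0)\in\mathbb{R}^2$. Then for $u^*=(m_1^*,m_0^* )$, $$\tau^*_{u^*}=\mathbb{E}\big\{\mu_1(X,m_1^* )-\mu_0(X,m_0^* )\mid U=u^*\big\}.$$ Suppose in addition (A3) for all $x$, $u=(m_1,m_0)$: $e_u(x)=c_\rho\{F(M_1=m_1\mid X=x),F(M_0=m_0\mid X=x)\}\prod_{z\in\{0,1\}}f(M_z=m_z\mid X=x)$, where $F(M_z=\cdot\mid X=x)$ and $f(M_z=\cdot\mid X=x)$ are the conditional CDF and density of $M_z$ given $X=x$. Then for any $u^*=(m_1^*,m_0^* )\in\mathbb{R}^2$ with $e_{u^*}>0$, $$\tau^*_{u^*}=\frac{\mathbb{E}\big[\{\mu_1(X,m_1^* )-\mu_0(X,m_0^* )\}e_{u^*}(X)\big]}{e_{u^*}},\qquad e_{u^*}(X)=c_\rho\{F_{1m_1^*}(X),F_{0m_0^*}(X)\}\prod_{z\in\{0,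1\}}f_{zm_z^*}(X).$$
   Context: Notation: $\tau^*_{u}=\mathbb{E}(Y_1-Y_0\mid U=u)$ is the principal causal effect with continuous strata; $\mu_z(x,m)=\mathbb{E}(Y\mid X=x,Z=z,M=m)$; $e_u(x)=f(U=u\mid X=x)$ is the conditional density of $U$ given $X$; $e_u=\mathbb{E}\{e_u(X)\}=f(U=u)$; $f_{zm}(x)=f(M=m\mid X=x,Z=z)$ and $F_{zm}(x)=\mathbb{P}(M\le m\mid X=x,Z=z)$. $c_\rho(\cdot,\cdot)$ is a specified (known) bivariate copula density with a specified correlation parameter $\rho$. *)

(* Defs.v *)
From HB Require Import structures.
From mathcomp Require Import all_boot all_order all_algebra.
From mathcomp Require Import all_classical all_reals all_analysis.
Set Implicit Arguments. Unset Strict Implicit. Unset Printing Implicit Defensive.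
Import Order.TTheory GRing.Theory Num.Theory.
Import numFieldNormedType.Exports.
Local Open Scope classical_set_scope.
Local Open Scope ring_scope.

Section defs.
Context {R : realType} {d : measure_display} {Omega : measurableType d}
  (P : probability Omega R).

Definition cond_exp_version {dS} {S : measurableType dS}
    (W : Omega -> R) (V : Omega -> S) (g : S -> R) : Prop :=
  [/\ measurable_fun setT g,
      P.-integrable setT (EFin \o W),
      P.-integrable setT (EFin \o (g \o V)) &
      forall B : set S, measurable B ->
        (\int[P]_(w in V @^-1` B) (W w)%:E
         = \int[P]_(w in V @^-1` B) (g (V w))%:E)%E].

Definition cond_indep {dZ dW dX} {SZ : measurableType dZ}
    {SW : measurableType dW} {SX : measurableType dX}
    (Z : Omega -> SZ) (W : Omega -> SW) (X : Omega -> SX) : Prop :=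
  forall (C : set SZ) (B : set SW), measurable C -> measurable B ->
  exists p q : SX -> R,
    [/\ cond_exp_version (\1_(Z @^-1` C)) X p,
        cond_exp_version (\1_(W @^-1` B)) X q &
        cond_exp_version (\1_(Z @^-1` C `&` W @^-1` B)) X (p \* q)].

Definition cond_cdf {dS} {S : measurableType dS}
    (W : Omega -> R) (V : Omega -> S) (F : S -> R -> R) : Prop :=
  forall m : R, cond_exp_version (\1_(W @^-1` `]-oo, m])) V (fun s => F s m).

Definition cond_density {dS} {S : measurableType dS}
    (W : Omega -> R) (V : Omega -> S) (f : S -> R -> R) : Prop :=
  [/\ measurable_fun setT (fun p : S * R => f p.1 p.2),
      (forall s m, 0 <= f s m) &
      forall (A : set S) (B : set R), measurable A -> measurable B ->
        P (V @^-1` A `&` W @^-1` B)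
        = (\int[P]_(w in V @^-1` A)
             \int[lebesgue_measure]_(m in B) (f (V w) m)%:E)%E].

Definition cond_density2 {dS} {S : measurableType dS}
    (W1 W0 : Omega -> R) (V : Omega -> S) (e : S -> R -> R -> R) : Prop :=
  [/\ measurable_fun setT (fun p : S * (R * R) => e p.1 p.2.1 p.2.2),
      (forall s m1 m0, 0 <= e s m1 m0) &
      forall (A : set S) (B : set (R * R)), measurable A -> measurable B ->
        P (V @^-1` A `&` (fun w => (W1 w, W0 w)) @^-1` B)
        = (\int[P]_(w in V @^-1` A)
             \int[lebesgue_measure]_m1 \int[lebesgue_measure]_m0
               (\1_B (m1, m0) * e (V w) m1 m0)%:E)%E].

End defs.

Definition copula_density {R : realType} (c : R -> R -> R) : Prop :=
  [/\ measurable_fun setT (fun p : R * R => c p.1 p.2),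
      (forall s t, 0 <= c s t),
      (forall a : R, 0 <= a <= 1 ->
        (\int[lebesgue_measure]_(s in `[0%R, a]) \int[lebesgue_measure]_(t in `[0%R, 1%R])
           (c s t)%:E = a%:E)%E) &
      (forall b : R, 0 <= b <= 1 ->
        (\int[lebesgue_measure]_(s in `[0%R, 1%R]) \int[lebesgue_measure]_(t in `[0%R, b])
           (c s t)%:E = b%:E)%E)].

Definition zsel {R : realType} {T : Type} (f1 f0 : T -> R -> R)
  (p : T * R) (m : R) : R := if p.2 == 1 then f1 p.1 m else f0 p.1 m.

Definition mix {R : realType} {Omega : Type} (Z A B : Omega -> R) : Omega -> R :=
  fun w => Z w * A w + (1 - Z w) * B w.

(* Main.v *)
(* Write W = (M_0, M_1, Y_0, Y_1) and E_z = {Z = z}.  By (A1) and positivity there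
   is a positive function p_z of X, a version of P(Z = z | X), such that
   integrating any function of (X, W) over E_z amounts to weighting it by p_z(X).
   Hence conditional expectations given X and functions of W agree with those
   computed on the stratum E_z, where the observed M and Y are M_z and Y_z, and
   a set defined by (X, W) that is null on E_z is null.  This identifies
   mu_z(X, M_z) with E(Y_z | X, M_z), which is E(Y_z | X, U) by (A2): the first
   claim.  It likewise identifies F_z and f_z with the conditional CDF and density
   of M_z given X, so (A3) turns into the displayed formula for e_u(X).  Finally
   e is the density of the law of (X, U) with respect to P_X times Lebesgue
   measure, so the first claim, tested on {U in B} for all Borel B, reads
   E[{mu_1 - mu_0 - tau_u} e_u(X)] = 0 for almost every u. *)
Require Import Defs.
From HB Require Import structures.
From mathcomp Require Import all_boot all_order all_algebra.
From mathcomp Require Import all_classical all_reals all_analysis measurable_realfun.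
Import Order.TTheory GRing.Theory Num.Theory.
Import numFieldNormedType.Exports.
Local Open Scope classical_set_scope.
Local Open Scope ring_scope.

Set Implicit Arguments.
Unset Strict Implicit.
Unset Printing Implicit Defensive.

(** * Restricted integrals and measurability of preimages and comparison sets *)

Lemma integral_indic_setT {d} {T : measurableType d} {R : realType}
    (mu : {measure set T -> \bar R}) (A : set T) (f : T -> \bar R) :
  (\int[mu]_(x in A) f x = \int[mu]_x (f x * (\1_A x)%:E))%E.
Proof. by rewrite integral_mkcond epatch_indic. Qed.

Lemma measurable_preimage {d d'} {T : measurableType d} {T' : measurableType d'}
    (f : T -> T') (B : set T') :
  measurable_fun setT f -> measurable B -> measurable (f @^-1` B).
Proof. by move=> mf mB; rewrite -[X in measurable X]setTI; exact: mf. Qed.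

Lemma measurable_set_lt {d} {T : measurableType d} {R : realType}
    (f g : T -> R) : measurable_fun setT f -> measurable_fun setT g ->
  measurable [set x | f x < g x].
Proof.
move=> /measurable_EFinP mf /measurable_EFinP mg.
rewrite [X in measurable X](_ : _ = setT `&` [set x | (f x)%:E < (g x)%:E]%E).
  exact: measurable_lte.
by rewrite setTI.
Qed.

Lemma measurable_set_neq {d} {T : measurableType d} {R : realType}
    (f g : T -> R) : measurable_fun setT f -> measurable_fun setT g ->
  measurable [set x | f x != g x].
Proof.
move=> /measurable_EFinP mf /measurable_EFinP mg.
rewrite [X in measurable X](_ : _ = setT `&` [set x | (f x)%:E != (g x)%:E]%E).
  exact: measurable_neqe.
by rewrite setTI.
Qed.

(** * Weighted measures, their images, and their determination by rectangles *)

Section density_measure.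
Local Open Scope ereal_scope.
Context {d} {T : measurableType d} {R : realType}.
Context (mu : {measure set T -> \bar R}) (w : T -> R).
Hypotheses (mw : measurable_fun setT w) (w0 : forall x, (0 <= w x)%R).

(** The two proofs are arguments so that the measure structure declared below can be inferred from
    the term itself. *)
Definition density_measure of measurable_fun setT w & (forall x, 0 <= w x)%R :=
  fun A : set T => \int[mu]_(x in A) (w x)%:E.

Local Notation nu := (density_measure mw w0).

Let nu0 : nu set0 = 0. Proof. exact: integral_set0. Qed.

Let nu_ge0 A : 0 <= nu A.
Proof. by apply: integral_ge0 => x _; rewrite lee_fin. Qed.

Let nu_sigma_additive : semi_sigma_additive nu.
Proof.
apply: semi_sigma_additive_nng_induced; first exact/measurable_EFinP.
by move=> x; rewrite lee_fin.
Qed.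

HB.instance Definition _ := isMeasure.Build _ _ _ nu
  nu0 nu_ge0 nu_sigma_additive.

Import HBNNSimple.

(** Monotone convergence along simple approximations of [f] reduces both sides to indicators, where
    the identity is the definition of the weighted measure. *)
Lemma ge0_integral_density_measure (f : T -> \bar R) :
  measurable_fun setT f -> (forall x, 0 <= f x) ->
  \int[nu]_x f x = \int[mu]_x (f x * (w x)%:E).
Proof.
move=> mf f0; pose g := nnsfun_approx measurableT mf.
have gf x : EFin \o g ^~ x @ \oo --> f x by exact: cvg_nnsfun_approx.
have g_nd x : {homo (fun n => (g n x)%:E) : m n / (m <= n)%N >-> m <= n}.
  by move=> m n mn; rewrite lee_fin; exact/lefP/nd_nnsfun_approx.
transitivity (limn (fun n => \int[nu]_x (g n x)%:E)).
  rewrite -monotone_convergence//.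
  - by apply: eq_integral => x _; apply/esym/cvg_lim => //; exact: gf.
  - by move=> n; exact/measurable_EFinP.
  - by move=> n x _; rewrite lee_fin.
transitivity (limn (fun n => \int[mu]_x ((g n x)%:E * (w x)%:E))); last first.
  rewrite -monotone_convergence//.
  - apply: eq_integral => x _; apply/cvg_lim => //.
    by apply: cvgeZr => //; exact: gf.
  - by move=> n; apply: emeasurable_funM; exact/measurable_EFinP.
  - by move=> n x _; rewrite mule_ge0// lee_fin.
  - by move=> x _ m n mn; apply: lee_wpmul2r; [rewrite lee_fin|exact: g_nd].
congr (limn _); apply/funext => n.
under [LHS]eq_integral do rewrite fimfunE -fsumEFin//.
rewrite ge0_integral_fsum//; last 2 first.
- by move=> y; exact/measurable_EFinP/measurable_funM.
- by move=> y x _; rewrite nnfun_muleindic_ge0.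
under [RHS]eq_integral.
  move=> x _; rewrite fimfunE -fsumEFin// ge0_mule_fsuml; last first.
    by move=> y; rewrite nnfun_muleindic_ge0.
  over.
rewrite ge0_integral_fsum//; last 2 first.
- move=> y; apply: emeasurable_funM; last exact/measurable_EFinP.
  exact/measurable_EFinP/measurable_funM.
- by move=> y x _; rewrite mule_ge0 ?nnfun_muleindic_ge0// lee_fin.
apply: eq_fsbigr => r /set_mem/= [x _ gxr].
have r0 : (0 <= r)%R by rewrite -gxr.
under [RHS]eq_integral do rewrite EFinM -muleA.
rewrite integralZl_indic_nnsfun// ge0_integralZl_EFin//; last 2 first.
- by move=> t _; rewrite mule_ge0// lee_fin.
- by apply: emeasurable_funM; exact/measurable_EFinP.
congr (_ * _); rewrite integral_indic// setIT.
under eq_integral do rewrite muleC.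
by rewrite /= /density_measure integral_indic_setT.
Qed.

End density_measure.

Section weighted_image.
Local Open Scope ereal_scope.
Context {d1 d2 dS} {T1 : measurableType d1} {T2 : measurableType d2}
  {S : measurableType dS} {R : realType}.
Context (mu1 : {measure set T1 -> \bar R}) (mu2 : {measure set T2 -> \bar R}).
Context (w1 : T1 -> R) (w2 : T2 -> R) (V1 : T1 -> S) (V2 : T2 -> S).
Hypotheses (mw1 : measurable_fun setT w1) (w1_ge0 : forall x, (0 <= w1 x)%R).
Hypotheses (mw2 : measurable_fun setT w2) (w2_ge0 : forall x, (0 <= w2 x)%R).
Hypotheses (mV1 : measurable_fun setT V1) (mV2 : measurable_fun setT V2).

(** Each side integrates [h] against the image of a weighted measure; the hypothesis says that the
    two images agree on measurable sets. *)
Lemma eq_ge0_integral_weighted (h : S -> \bar R) :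
  (forall D, measurable D -> \int[mu1]_(x in V1 @^-1` D) (w1 x)%:E =
                             \int[mu2]_(x in V2 @^-1` D) (w2 x)%:E) ->
  measurable_fun setT h -> (forall s, 0 <= h s) ->
  \int[mu1]_x (h (V1 x) * (w1 x)%:E) = \int[mu2]_x (h (V2 x) * (w2 x)%:E).
Proof.
move=> w12 mh h0.
rewrite -(ge0_integral_density_measure mu1 mw1 w1_ge0 (f := h \o V1)); last 2 first.
- exact: measurableT_comp.
- by move=> x /=.
rewrite -(ge0_integral_density_measure mu2 mw2 w2_ge0 (f := h \o V2)); last 2 first.
- exact: measurableT_comp.
- by move=> x /=.
(* Writing the domain as a preimage of the full set exposes the change of variables for image
   measures. *)
rewrite -[LHS]/(\int[_]_(x in V1 @^-1` setT) (h \o V1) x).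
rewrite -[RHS]/(\int[_]_(x in V2 @^-1` setT) (h \o V2) x).
rewrite -!ge0_integral_pushforward//.
by apply: eq_measure_integral => A mA _; exact: w12.
Qed.

End weighted_image.

(** Rectangles are stable under intersection and generate the product sigma-algebra; the full space
    is itself a rectangle, of finite mass, so the uniqueness theorem for measures applies. *)
Lemma eq_weighted_rectangles {d1 d2 dA dB} {T1 : measurableType d1}
    {T2 : measurableType d2} {SA : measurableType dA} {SB : measurableType dB}
    {R : realType}
    (mu1 : {measure set T1 -> \bar R}) (mu2 : {measure set T2 -> \bar R})
    (w1 : T1 -> R) (w2 : T2 -> R)
    (V1 : T1 -> SA * SB) (V2 : T2 -> SA * SB) :
  measurable_fun setT w1 -> (forall x, 0 <= w1 x) ->
  measurable_fun setT w2 -> (forall x, 0 <= w2 x) ->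
  measurable_fun setT V1 -> measurable_fun setT V2 ->
  (\int[mu1]_x (w1 x)%:E < +oo)%E ->
  (forall A B, measurable A -> measurable B ->
    \int[mu1]_(x in V1 @^-1` (A `*` B)) (w1 x)%:E =
    \int[mu2]_(x in V2 @^-1` (A `*` B)) (w2 x)%:E)%E ->
  forall D, measurable D -> (\int[mu1]_(x in V1 @^-1` D) (w1 x)%:E =
                             \int[mu2]_(x in V2 @^-1` D) (w2 x)%:E)%E.
Proof.
move=> mw1 w1_ge0 mw2 w2_ge0 mV1 mV2 w1oo w12 D mD.
pose G : set (set (SA * SB)) :=
  [set C | exists2 A, measurable A & exists2 B, measurable B & A `*` B = C].
rewrite -[LHS]/(pushforward (density_measure mu1 mw1 w1_ge0) V1 D).
rewrite -[RHS]/(pushforward (density_measure mu2 mw2 w2_ge0) V2 D).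
apply: (measure_unique G (fun=> setT)) => //.
- by rewrite measurable_prod_measurableType.
- move=> _ _ [A1 mA1 [B1 mB1 <-]] [A2 mA2 [B2 mB2 <-]].
  exists (A1 `&` A2); first exact: measurableI.
  by exists (B1 `&` B2); [exact: measurableI|rewrite setXI].
- by move=> _; exists setT => //; exists setT => //; rewrite setXTT.
- by rewrite bigcup_const//; exists 0%N.
- by move=> _ [A mA [B mB <-]]; exact: w12.
Qed.

(** * Null sets obtained from equality of integrals *)

(** The set where [f] lies below [g] is itself an admissible test set [D]. There [g - f] is positive
    with zero integral, which forces the set to be null. *)
Lemma measure0_lt_preimage {d dS} {T : measurableType d} {S : measurableType dS}
    {R : realType} (mu : {measure set T -> \bar R}) (E : set T) (V : T -> S)
    (f g : S -> R) :
  measurable E -> measurable_fun setT V ->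
  measurable_fun setT f -> measurable_fun setT g ->
  mu.-integrable E (fun x => (f (V x))%:E) ->
  mu.-integrable E (fun x => (g (V x))%:E) ->
  (forall D, measurable D -> \int[mu]_(x in E `&` V @^-1` D) (f (V x))%:E =
                             \int[mu]_(x in E `&` V @^-1` D) (g (V x))%:E)%E ->
  mu (E `&` V @^-1` [set s | f s < g s]) = 0%E.
Proof.
move=> mE mV mf mg fi gi fg; set D := [set s | _].
have mD : measurable D by exact: measurable_set_lt.
have mVD : measurable (V @^-1` D) by exact: measurable_preimage.
set F := E `&` _; have mF : measurable F by exact: measurableI.
have FE : F `<=` E by exact: subIsetl.
have {}fi := integrableS mE mF FE fi.
have {}gi := integrableS mE mF FE gi.
have : (\int[mu]_(x in F) `|(g (V x))%:E - (f (V x))%:E| = 0)%E.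
  under eq_integral.
    move=> x /set_mem[_ Dx].
    rewrite gee0_abs -?EFinB ?lee_fin ?subr_ge0; last exact: ltW.
    rewrite EFinB; over.
  by rewrite integralB//= -fg// subee// integrable_fin_num.
move/(ae_eq_integral_abs mu mF); case.
  by apply: emeasurable_funB; [exact: measurable_int gi|exact: measurable_int fi].
move=> N [mN N0 FN]; apply: (subset_measure0 mF mN _ N0) => x Fx; apply: FN => /=.
move=> /(_ Fx)/eqP; rewrite -EFinB eqe subr_eq0 => /eqP gf.
by case: Fx => _; rewrite /D /= gf ltxx.
Qed.

Lemma measure0_neq_preimage {d dS} {T : measurableType d} {S : measurableType dS}
    {R : realType} (mu : {measure set T -> \bar R}) (E : set T) (V : T -> S)
    (f g : S -> R) :
  measurable E -> measurable_fun setT V ->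
  measurable_fun setT f -> measurable_fun setT g ->
  mu.-integrable E (fun x => (f (V x))%:E) ->
  mu.-integrable E (fun x => (g (V x))%:E) ->
  (forall D, measurable D -> \int[mu]_(x in E `&` V @^-1` D) (f (V x))%:E =
                             \int[mu]_(x in E `&` V @^-1` D) (g (V x))%:E)%E ->
  mu (E `&` V @^-1` [set s | f s != g s]) = 0%E.
Proof.
move=> mE mV mf mg fi gi fg.
have lt0 := measure0_lt_preimage mE mV mf mg fi gi fg.
have gt0 : mu (E `&` V @^-1` [set s | g s < f s]) = 0%E.
  by apply: measure0_lt_preimage => // D mD; rewrite fg.
have mlt (f' g' : S -> R) : measurable_fun setT f' -> measurable_fun setT g' ->
    measurable (E `&` V @^-1` [set s | f' s < g' s]).
  move=> mf' mg'; apply: measurableI => //.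
  by apply: measurable_preimage => //; exact: measurable_set_lt.
rewrite [X in mu X](_ : _ = (E `&` V @^-1` [set s | f s < g s]) `|`
                            (E `&` V @^-1` [set s | g s < f s])).
  by rewrite measureU0//; exact: mlt.
rewrite -setIUr; congr (_ `&` _); apply/seteqP; split => x /=.
  by rewrite neq_lt => /orP.
by move=> fgx; rewrite neq_lt; apply/orP.
Qed.

(** * Integration against a joint density *)

(** The hypothesis on [P] is the case of indicators of rectangles. The product is taken over
    [T * U], with [V] applied to the first coordinate, so the law of [V] never has to be formed. *)
Lemma ge0_integral_joint_density {d dS dU} {T : measurableType d}
    {S : measurableType dS} {U : measurableType dU} {R : realType}
    (P : probability T R) (la : {sigma_finite_measure set U -> \bar R})
    (V : T -> S) (W : T -> U) (f : S * U -> R) (h : S * U -> \bar R) :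
  measurable_fun setT V -> measurable_fun setT W ->
  measurable_fun setT f -> (forall z, 0 <= f z) ->
  (forall A B, measurable A -> measurable B ->
    P (V @^-1` A `&` W @^-1` B) =
    \int[P]_(w in V @^-1` A) \int[la]_(u in B) (f (V w, u))%:E)%E ->
  measurable_fun setT h -> (forall z, 0 <= h z)%E ->
  (\int[P]_w h (V w, W w) =
   \int[P \x la]_z (h (V z.1, z.2) * (f (V z.1, z.2))%:E))%E.
Proof.
move=> mV mW mf f0 PVW mh h0.
have mV2 : measurable_fun setT (fun z : T * U => (V z.1, z.2)).
  by apply: measurable_fun_pair => //; exact: measurableT_comp.
have mVW : measurable_fun setT (fun w => (V w, W w)) by exact: measurable_fun_pair.
have mfV : measurable_fun setT (fun z : T * U => f (V z.1, z.2)).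
  exact: measurableT_comp.
(* The constant weight 1 puts the left side in the weighted form. *)
under eq_integral do rewrite -[h _]mule1.
apply: (eq_ge0_integral_weighted (w1 := cst 1) (V1 := fun w => (V w, W w))
  (V2 := fun z : T * U => (V z.1, z.2))) => //.
apply: eq_weighted_rectangles => //.
  rewrite [X in (X < _)%E](integral_cst P measurableT 1%:E) mul1e.
  exact: le_lt_trans (probability_le1 P measurableT) (ltry 1).
move=> A B mA mB.
have mVA : measurable (V @^-1` A) by exact: measurable_preimage.
have mWB : measurable (W @^-1` B) by exact: measurable_preimage.
rewrite [LHS](integral_cst P (measurableI _ _ mVA mWB) 1%:E).
rewrite mul1e -[LHS]/(P (V @^-1` A `&` W @^-1` B)) PVW//.
rewrite [LHS]integral_indic_setT [RHS]integral_indic_setT.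
rewrite fubini_tonelli1; last 2 first.
- apply/measurable_EFinP/measurable_funM => //; apply: measurable_indic.
  by apply: measurable_preimage => //; exact: measurableX.
- by move=> z; rewrite -EFinM lee_fin mulr_ge0.
apply: eq_integral => w _; rewrite /fubini_F/= [in LHS]integral_indic_setT.
rewrite -ge0_integralZr//.
- apply: eq_integral => u _; rewrite -!EFinM -mulrA; congr (_ * _)%:E.
  rewrite !indicE -natrM mulnb andbC; congr ((_ : bool)%:R).
  by apply/andP/idP => [[/set_mem ? /set_mem ?]|/set_mem[? ?]];
    [exact/mem_set|split; exact/mem_set].
- apply/measurable_EFinP/measurable_funM => //.
  by apply: measurableT_comp => //; exact: measurable_pair1.
- by move=> u _; rewrite -EFinM lee_fin mulr_ge0.
Qed.

(** * Signed integrands; pull-out and uniqueness for conditional expectations *)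

Lemma addr_norm_ge0 {R : realDomainType} (x : R) : 0 <= x + `|x|.
Proof. by rewrite -lerBlDl sub0r -normrN ler_norm. Qed.

(** The defining identity of [g] is the case of indicators [h]; viewing [W] and [g (V w)] as
    weights, the transfer of weighted integrals extends it to nonnegative [h]. *)
Lemma cond_exp_pullout {d dS} {T : measurableType d} {S : measurableType dS}
    {R : realType} (P : probability T R) (W : T -> R) (V : T -> S)
    (g h : S -> R) :
  measurable_fun setT V -> cond_exp_version P W V g ->
  measurable_fun setT h -> (forall s, 0 <= h s) ->
  P.-integrable setT (fun w => (h (V w) * W w)%:E) ->
  P.-integrable setT (fun w => (h (V w) * g (V w))%:E) ->
  (\int[P]_w (h (V w) * W w)%:E = \int[P]_w (h (V w) * g (V w))%:E)%E.
Proof.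
move=> mV [mg iW ig Wg] mh h0 ihW ihg.
have mgV : measurable_fun setT (g \o V) by exact: measurableT_comp.
have mW : measurable_fun setT W by apply/measurable_EFinP; exact: measurable_int iW.
(* Adding [k] to both sides makes both weights nonnegative. *)
pose k w : R := `|W w| + `|g (V w)|.
have mk : measurable_fun setT k.
  by apply: measurable_funD; exact: measurableT_comp.
have ik : P.-integrable setT (EFin \o k).
  rewrite (_ : _ \o _ = (EFin \o (Num.norm \o W)) \+ (EFin \o (Num.norm \o (g \o V))))%E//.
  by apply: integrableD => //; exact: integrable_norm.
have ihk : P.-integrable setT (fun w => (h (V w) * k w)%:E).
  rewrite (_ : (fun _ => _) = (EFin \o (Num.norm \o (fun w => h (V w) * W w)%R)) \+
    (EFin \o (Num.norm \o (fun w => h (V w) * g (V w))%R)))%E; last first.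
    by apply/funext => w /=; rewrite !normrM !(ger0_norm (h0 _)) -EFinD -mulrDr.
  by apply: integrableD => //; exact: integrable_norm.
have Wk0 w : 0 <= W w + k w.
  by rewrite addrA addr_ge0// addr_norm_ge0.
have gk0 w : 0 <= g (V w) + k w.
  by rewrite addrCA addr_ge0// addr_norm_ge0.
have Wgk D : measurable D -> (\int[P]_(w in V @^-1` D) (W w + k w)%:E =
    \int[P]_(w in V @^-1` D) (g (V w) + k w)%:E)%E.
  move=> mD; have mVD := measurable_preimage mV mD.
  under eq_integral do rewrite EFinD.
  under [RHS]eq_integral do rewrite EFinD.
  rewrite integralD//; [|exact: integrableS iW|exact: integrableS ik].
  rewrite integralD//; [|exact: integrableS ig|exact: integrableS ik].
  by rewrite Wg.
have := eq_ge0_integral_weighted (w1 := W \+ k) (w2 := (g \o V) \+ k)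
  (measurable_funD mW mk) Wk0 (measurable_funD mgV mk) gk0 mV mV Wgk
  (h := EFin \o h).
move=> /(_ _ _)/wrap[]; [exact/measurable_EFinP|by move=> s; rewrite lee_fin|].
under eq_integral do rewrite /= -EFinM mulrDr EFinD.
under [RHS]eq_integral do rewrite /= -EFinM mulrDr EFinD.
rewrite integralD// integralD//.
have khfin : (\int[P]_w (h (V w) * k w)%:E)%E \is a fin_num.
  exact: integrable_fin_num.
by move=> /(congr1 (fun z => z - \int[P]_w (h (V w) * k w)%:E)%E); rewrite !addeK.
Qed.

(** The nonnegative case is applied to the absolute value of [h], which gives integrability, and to
    [h] plus its absolute value; subtracting the two finite integrals leaves [h]. *)
Lemma eq_integral_weighted {d1 d2 dS} {T1 : measurableType d1}
    {T2 : measurableType d2} {S : measurableType dS} {R : realType}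
    (mu1 : {measure set T1 -> \bar R}) (mu2 : {measure set T2 -> \bar R})
    (w1 : T1 -> R) (w2 : T2 -> R) (V1 : T1 -> S) (V2 : T2 -> S) (h : S -> R) :
  (forall x, 0 <= w1 x) ->
  measurable_fun setT w2 -> (forall x, 0 <= w2 x) -> measurable_fun setT V2 ->
  (forall k : S -> \bar R, measurable_fun setT k -> (forall s, 0 <= k s)%E ->
    \int[mu1]_x (k (V1 x) * (w1 x)%:E) = \int[mu2]_x (k (V2 x) * (w2 x)%:E))%E ->
  measurable_fun setT h ->
  mu1.-integrable setT (fun x => (h (V1 x) * w1 x)%:E) ->
  mu2.-integrable setT (fun x => (h (V2 x) * w2 x)%:E) /\
  (\int[mu1]_x (h (V1 x) * w1 x)%:E = \int[mu2]_x (h (V2 x) * w2 x)%:E)%E.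
Proof.
move=> w1_ge0 mw2 w2_ge0 mV2 w12 mh ih1.
have mhw2 : measurable_fun setT (fun x => h (V2 x) * w2 x).
  by apply: measurable_funM => //; exact: measurableT_comp.
have absE1 x : (`|h (V1 x)|%:E * (w1 x)%:E)%E = `|(h (V1 x) * w1 x)%:E|%E.
  by rewrite -EFinM /= normrM (ger0_norm (w1_ge0 x)).
have absE2 x : (`|h (V2 x)|%:E * (w2 x)%:E)%E = `|(h (V2 x) * w2 x)%:E|%E.
  by rewrite -EFinM /= normrM (ger0_norm (w2_ge0 x)).
have mabsh : measurable_fun setT (fun s => `|h s|) by exact: measurableT_comp.
have ih2 : mu2.-integrable setT (fun x => (h (V2 x) * w2 x)%:E).
  apply/integrableP; split; first exact/measurable_EFinP.
  under eq_integral do rewrite -absE2.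
  rewrite -(w12 (fun s => `|h s|%:E))//; last exact/measurable_EFinP.
  by under eq_integral do rewrite absE1; case/integrableP: ih1.
split => //.
have := w12 (fun s => (h s + `|h s|)%:E).
move=> /(_ _ _)/wrap[]; [by apply/measurable_EFinP/measurable_funD|
  by move=> s; rewrite lee_fin addr_norm_ge0|].
under eq_integral do rewrite EFinD muleDl// absE1 -EFinM.
under [RHS]eq_integral do rewrite EFinD muleDl// absE2 -EFinM.
rewrite integralD//; last exact: integrable_abse.
rewrite integralD//; last exact: integrable_abse.
under [X in (_ + X = _)%E]eq_integral do rewrite -absE1.
under [X in (_ = _ + X)%E]eq_integral do rewrite -absE2.
rewrite (w12 (fun s => `|h s|%:E))//; last exact/measurable_EFinP.
have fin : (\int[mu2]_x (`|h (V2 x)|%:E * (w2 x)%:E))%E \is a fin_num.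
  under eq_integral do rewrite absE2.
  by apply: integrable_fin_num => //; exact: integrable_abse.
by move=> /(congr1 (fun z => z - \int[mu2]_x (`|h (V2 x)|%:E * (w2 x)%:E))%E);
  rewrite !addeK.
Qed.

Lemma ae_eq_integrable {d} {T : measurableType d} {R : realType}
    (mu : {measure set T -> \bar R}) (f g : T -> R) :
  measurable_fun setT g -> {ae mu, forall x, f x = g x} ->
  mu.-integrable setT (EFin \o f) -> mu.-integrable setT (EFin \o g).
Proof.
move=> /measurable_EFinP mg fg /integrableP[mf foo]; apply/integrableP; split => //.
rewrite (_ : (\int[mu]_x _ = \int[mu]_x `|(f x)%:E|)%E)//.
apply: ge0_ae_eq_integral => //; [exact: measurableT_comp..|].
by apply: filterS fg => x /= ->.
Qed.

Lemma measure0_aeN {d} {T : measurableType d} {R : realType}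
    (mu : {measure set T -> \bar R}) (A : set T) :
  measurable A -> mu A = 0%E -> {ae mu, forall x, ~ A x}.
Proof. by move=> mA A0; exists A; split => // x /= /contrapT. Qed.

Lemma aeN_measure0 {d} {T : measurableType d} {R : realType}
    (mu : {measure set T -> \bar R}) (A : set T) :
  measurable A -> {ae mu, forall x, ~ A x} -> mu A = 0%E.
Proof.
move=> mA [N [mN N0 AN]]; apply: subset_measure0 N0 => //.
by move=> x Ax; apply: AN => /=; exact.
Qed.

Lemma integrable_mul_indic {d} {T : measurableType d} {R : realType}
    (mu : {measure set T -> \bar R}) (A : set T) (f : T -> R) :
  measurable A -> mu.-integrable setT (EFin \o f) ->
  mu.-integrable setT (fun x => (f x * \1_A x)%:E).
Proof.
move=> mA fi; have /measurable_EFinP mf := measurable_int mu fi.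
apply: le_integrable fi => //.
  by apply/measurable_EFinP/measurable_funM => //; exact: measurable_indic.
move=> x _ /=; rewrite lee_fin normrM ler_piMr//.
by rewrite ger0_norm// indicE lern1 leq_b1.
Qed.

Lemma cond_exp_unique {d dS} {T : measurableType d} {S : measurableType dS}
    {R : realType} (P : probability T R) (W : T -> R) (V : T -> S) (g g' : S -> R) :
  measurable_fun setT V -> cond_exp_version P W V g -> cond_exp_version P W V g' ->
  {ae P, forall w, g (V w) = g' (V w)}.
Proof.
move=> mV [mg _ ig Wg] [mg' _ ig' Wg'].
have := measure0_neq_preimage measurableT mV mg mg' ig ig'.
move=> /(_ _)/wrap[D mD|]; first by rewrite setTI -Wg// -Wg'.
rewrite setTI => /measure0_aeN-/(_ (measurable_preimage mV (measurable_set_neq mg mg'))).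
by apply: filterS => w /= /negP; rewrite negbK => /eqP.
Qed.

(** * Propensity scores and transfer from a stratum to the whole space *)

(** This packs three facts: [p] is a version of the probability of [E] given [X], it is strictly
    positive, and [E] is independent of [W] given [X]. The last takes the form of replacing the
    indicator of [E] by [p (X w)] against every nonnegative function of [(X, W)]. *)
Definition propensity {d dX dW} {Omega : measurableType d} {SX : measurableType dX}
    {SW : measurableType dW} {R : realType} (P : probability Omega R)
    (E : set Omega) (X : Omega -> SX) (W : Omega -> SW) (p : SX -> R) :=
  [/\ measurable_fun setT p, (forall x, 0 < p x) &
      forall k : SX * SW -> \bar R, measurable_fun setT k -> (forall z, 0 <= k z)%E ->
      (\int[P]_w (k (X w, W w) * (\1_E w)%:E) =
       \int[P]_w (k (X w, W w) * (p (X w))%:E))%E].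

Section propensity.
Context {d dX dW} {Omega : measurableType d} {SX : measurableType dX}
  {SW : measurableType dW} {R : realType} (P : probability Omega R).
Variables (E : set Omega) (X : Omega -> SX) (W : Omega -> SW) (p : SX -> R).
Hypotheses (mE : measurable E) (mX : measurable_fun setT X)
  (mW : measurable_fun setT W) (pE : propensity P E X W p).

Let XW w := (X w, W w).

Let mXW : measurable_fun setT XW. Proof. exact: measurable_fun_pair. Qed.

(** The indicator of [N] weighted by [p] integrates to the mass of [N] on [E], which is zero; since
    [p] is positive, the indicator itself vanishes almost surely. *)
Lemma propensity_null (N : set (SX * SW)) :
  measurable N -> P (E `&` XW @^-1` N) = 0%E -> P (XW @^-1` N) = 0%E.
Proof.
case: pE => mp p0 pk mN EN0; have mXWN := measurable_preimage mXW mN.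
have mk : measurable_fun setT (fun w => (\1_N (XW w))%:E * (p (X w))%:E)%E.
  apply/measurable_EFinP/measurable_funM; last exact: measurableT_comp.
  by apply: measurableT_comp => //; exact: measurable_indic.
have : (\int[P]_w `|(\1_N (XW w))%:E * (p (X w))%:E| = 0)%E.
  under eq_integral do rewrite gee0_abs -?EFinM ?lee_fin ?mulr_ge0 ?(ltW (p0 _))// EFinM.
  rewrite -(pk (fun z => (\1_N z)%:E))//; first last.
    by apply/measurable_EFinP; exact: measurable_indic.
  rewrite -integral_indic_setT (integral_indic P mE mXWN).
  by rewrite setIC.
move/(ae_eq_integral_abs P measurableT mk) => h; apply: aeN_measure0 => //.
apply: filterS h => w /= /(_ I) + Nw; rewrite indicE mem_set// -EFinM mul1r.
by move=> /eqP; rewrite eqe gt_eqF.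
Qed.

Lemma propensity_integral (h : SX * SW -> R) :
  measurable_fun setT h -> P.-integrable setT (fun w => (h (XW w))%:E) ->
  P.-integrable setT (fun w => (h (XW w) * p (X w))%:E) /\
  (\int[P]_(w in E) (h (XW w))%:E = \int[P]_w (h (XW w) * p (X w))%:E)%E.
Proof.
case: pE => mp p0 pk mh ih; rewrite integral_indic_setT.
apply: (@eq_integral_weighted _ _ _ _ _ _ _ P P (\1_E) (p \o X) XW XW) => //.
- exact: measurableT_comp.
- by move=> w /=; exact: ltW (p0 _).
- exact: integrable_mul_indic.
Qed.

(** Here [v] extracts the conditioning variable from [(X, W)], and [pr] recovers [X] from it. Hence
    [p] is a function of the conditioning variable and can be pulled out: [g] remains a conditional
    expectation of [phi] inside [E], so it agrees there with [g'], and positivity of [p] removes the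
    restriction to [E]. *)
Lemma propensity_cond_exp {dV} {SV : measurableType dV} (v : SX * SW -> SV)
    (pr : SV -> SX) (phi : SX * SW -> R) (g g' : SV -> R) :
  measurable_fun setT v -> measurable_fun setT pr -> (forall z, pr (v z) = z.1) ->
  measurable_fun setT phi ->
  cond_exp_version P (phi \o XW) (v \o XW) g ->
  measurable_fun setT g' -> P.-integrable E (fun w => (g' (v (XW w)))%:E) ->
  (forall D, measurable D ->
    \int[P]_(w in E `&` (v \o XW) @^-1` D) (phi (XW w))%:E =
    \int[P]_(w in E `&` (v \o XW) @^-1` D) (g' (v (XW w)))%:E)%E ->
  {ae P, forall w, g (v (XW w)) = g' (v (XW w))}.
Proof.
move=> mv mpr prv mphi gP mg' ig' phig'; have [mp p0 _] := pE.
have mV : measurable_fun setT (v \o XW) by exact: measurableT_comp.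
have [mg iphi ig _] := gP.
have ind (f : SX * SW -> R) D : measurable_fun setT f ->
    P.-integrable setT (fun w => (f (XW w))%:E) -> measurable D ->
    P.-integrable setT (fun w => (\1_D (v (XW w)) * p (pr (v (XW w))) * f (XW w))%:E) /\
    (\int[P]_(w in E `&` (v \o XW) @^-1` D) (f (XW w))%:E =
     \int[P]_w (\1_D (v (XW w)) * p (pr (v (XW w))) * f (XW w))%:E)%E.
  move=> mf fi mD; have mvD := measurable_preimage mv mD.
  have := @propensity_integral (fun z => f z * \1_(v @^-1` D) z).
  move=> /(_ _ _)/wrap[||[i1 i2]].
  - by apply: measurable_funM => //; exact: measurable_indic.
  - apply: (@integrable_mul_indic _ _ _ P (XW @^-1` (v @^-1` D)) (f \o XW)) => //.
    exact: measurable_preimage.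
  split.
    apply: eq_integrable i1 => // w _; congr (_%:E).
    by rewrite prv -mulrA mulrC.
  rewrite integral_mkcondr epatch_indic.
  under eq_integral do rewrite -EFinM.
  rewrite [LHS]i2; apply: eq_integral => w _; congr (_%:E).
  by rewrite prv -mulrA mulrC.
suff : P (E `&` (v \o XW) @^-1` [set s | g s != g' s]) = 0%E.
  move=> /(@propensity_null (v @^-1` [set s | g s != g' s])).
  have mN := measurable_preimage mv (measurable_set_neq mg mg').
  move=> /(_ mN)/measure0_aeN => /(_ (measurable_preimage mXW mN)).
  by apply: filterS => w /= /negP; rewrite negbK => /eqP.
apply: measure0_neq_preimage => //; first exact: integrableS ig.
move=> D mD; rewrite -phig'// (ind phi D mphi iphi mD).2.
rewrite [LHS](ind (g \o v) D (measurableT_comp mg mv) ig mD).2; apply/esym.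
apply: (cond_exp_pullout (h := fun s => \1_D s * p (pr s)) mV gP).
- apply: measurable_funM; first exact: measurable_indic.
  exact: measurableT_comp.
- by move=> s; rewrite mulr_ge0// ltW.
- by case: (ind phi D mphi iphi mD).
- by case: (ind (g \o v) D (measurableT_comp mg mv) ig mD).
Qed.

End propensity.

(** Conditional independence gives the replacement of the indicator of [E] on rectangles in
    [(X, W)]; the extension to all nonnegative functions is then measure-theoretic. *)
Lemma propensity_exists {d dX dW dZ} {Omega : measurableType d}
    {SX : measurableType dX} {SW : measurableType dW} {SZ : measurableType dZ}
    {R : realType} (P : probability Omega R)
    (X : Omega -> SX) (W : Omega -> SW) (Z : Omega -> SZ) (C : set SZ) :
  measurable_fun setT X -> measurable_fun setT W -> measurable_fun setT Z ->
  measurable C -> cond_indep P Z W X ->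
  (forall A, measurable A -> (0 < P (X @^-1` A) -> 0 < P (X @^-1` A `&` Z @^-1` C))%E) ->
  exists p, propensity P (Z @^-1` C) X W p.
Proof.
move=> mX mW mZ mC ZWX pos; set E := Z @^-1` C.
have mE : measurable E by exact: measurable_preimage.
have mXW : measurable_fun setT (fun w => (X w, W w)) by exact: measurable_fun_pair.
(* With the full set as the event for [W], this only extracts a version of the probability of [E]
   given [X]. *)
have [p0 [_ [p0P _ _]]] := ZWX C setT mC measurableT.
have [mp0 _ ip0 Ep0] := p0P.
have mN : measurable [set x | p0 x <= 0].
  rewrite [X in measurable X](_ : _ = p0 @^-1` `]-oo, 0]); last first.
    by apply/seteqP; split => x /=; rewrite in_itv.
  exact: measurable_preimage.
have p0_gt0 : {ae P, forall w, 0 < p0 (X w)}.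
  have mXN := measurable_preimage mX mN.
  have XN0 : P (X @^-1` [set x | p0 x <= 0]) = 0%E.
    (* If [p0] were nonpositive with positive probability, positivity would give that event positive
       mass inside [E], while this mass is the integral of [p0] over it. *)
    apply/eqP; rewrite eq_le measure_ge0 andbT leNgt; apply/negP => /(pos _ mN).
    apply/negP; rewrite -leNgt setIC -(integral_indic P mXN mE) Ep0//.
    rewrite -[leRHS](integral0 P (X @^-1` [set x | p0 x <= 0])); apply: le_integral => //.
    - exact: integrableS ip0.
    - exact: integrable0.
    - by move=> w /set_mem /=; rewrite lee_fin.
  apply: filterS (measure0_aeN mXN XN0) => w /= /negP.
  by rewrite -ltNge.
(* Modifying [p0] on a null set makes it positive everywhere. *)
pose p x := if p0 x <= 0 then 1 else p0 x.
have p_gt0 x : 0 < p x by rewrite /p; case: ifPn => //; rewrite -ltNge.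
have mp : measurable_fun setT p.
  apply: measurable_fun_ifT => //; exact: measurable_fun_ler.
have p0p : {ae P, forall w, p0 (X w) = p (X w)}.
  by apply: filterS p0_gt0 => w w0; rewrite /p leNgt w0.
have mpX : measurable_fun setT (p \o X) by exact: measurableT_comp.
have ipX : P.-integrable setT (EFin \o (p \o X)).
  exact: ae_eq_integrable p0p ip0.
exists p; split => // k mk k0.
apply: (eq_ge0_integral_weighted (w1 := \1_E) (w2 := p \o X)
  (V1 := fun w => (X w, W w)) (V2 := fun w => (X w, W w))) => //.
  by move=> w /=; exact: ltW.
apply: eq_weighted_rectangles => //.
- by move=> w /=; exact: ltW.
- rewrite integral_indic// setIT.
  exact: le_lt_trans (probability_le1 P mE) (ltry 1).
move=> A B mA mB.
have mXA := measurable_preimage mX mA; have mWB := measurable_preimage mW mB.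
(* The version [pB] may depend on [B]; uniqueness identifies it almost surely with [p]. *)
have [pB [qB [pBP qBP pqP]]] := ZWX C B mC mB.
have pBp : {ae P, forall w, pB (X w) = p (X w)}.
  by apply: filterS2 p0p (cond_exp_unique mX pBP p0P) => w -> ->.
have [mpq iEW ipq Epq] := pqP; have [mqB _ iqB _] := qBP.
pose h x := \1_A x * p x.
have mh : measurable_fun setT h.
  by apply: measurable_funM => //; exact: measurable_indic.
have h_ge0 x : 0 <= h x by rewrite mulr_ge0// ltW.
have ihW : P.-integrable setT (fun w => (h (X w) * \1_(W @^-1` B) w)%:E).
  apply: (@integrable_mul_indic _ _ _ P _ (h \o X)) => //.
  apply: eq_integrable (integrable_mul_indic mXA ipX) => // w _.
  by rewrite /= mulrC.
have hq_ae : {ae P, forall w, pB (X w) * qB (X w) * \1_(X @^-1` A) w = h (X w) * qB (X w)}.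
  by apply: filterS pBp => w ->; rewrite mulrC mulrA.
have mhq : measurable_fun setT (fun w => h (X w) * qB (X w)).
  by apply: measurable_funM; exact: measurableT_comp.
have ihq : P.-integrable setT (fun w => (h (X w) * qB (X w))%:E).
  exact: ae_eq_integrable mhq hq_ae (integrable_mul_indic mXA ipq).
transitivity (\int[P]_(w in X @^-1` A) (\1_(E `&` W @^-1` B) w)%:E)%E.
  rewrite integral_indic//; last by apply: measurable_preimage => //; exact: measurableX.
  rewrite integral_indic//; last exact: measurableI.
  congr (P _); apply/seteqP; split => w /=; rewrite /E/=; tauto.
rewrite Epq// [LHS]integral_indic_setT.
transitivity (\int[P]_w (h (X w) * qB (X w))%:E)%E.
  apply: ae_eq_integral => //.
  - apply/measurable_EFinP/measurable_funM; last exact: measurable_indic.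
    by apply: measurableT_comp.
  - exact/measurable_EFinP.
  - by apply: filterS hq_ae => w /= <-.
(* Pulling out the weight [h] turns [qB] back into the indicator of [W] in [B]. *)
rewrite -(cond_exp_pullout mX qBP mh h_ge0 ihW ihq) [RHS]integral_indic_setT.
apply: eq_integral => w _; rewrite -EFinM /h mulrAC mulrC; congr (_ * _)%:E.
rewrite !indicE -natrM mulnb; congr ((_ : bool)%:R).
by apply/andP/idP => [[/set_mem ? /set_mem ?]|/set_mem[? ?]];
  [exact/mem_set|split; exact/mem_set].
Qed.

(** * Conditional expectations restricted to a stratum *)

(** The observed variable [V'] carries the stratum label through [s], and on the stratum [r] and [j]
    translate between [V'] and [V]. Thus an event of [V] inside the stratum is an event of [V'], and
    can be used to test [k]. *)
Lemma cond_exp_stratum {d dS dS'} {Omega : measurableType d}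
    {S : measurableType dS} {S' : measurableType dS'} {R : realType}
    (P : probability Omega R) (z : R) (V' : Omega -> S') (V : Omega -> S)
    (r : S' -> S) (s : S' -> R) (j : S -> S') (W' W : Omega -> R) (k : S' -> R) :
  measurable_fun setT V' -> measurable_fun setT r -> measurable_fun setT s ->
  (forall w, s (V' w) = z -> [/\ r (V' w) = V w, j (V w) = V' w & W' w = W w]) ->
  cond_exp_version P W' V' k ->
  let E := (s \o V') @^-1` [set z] in
  P.-integrable E (fun w => (k (j (V w)))%:E) /\
  (forall D, measurable D -> \int[P]_(w in E `&` V @^-1` D) (W w)%:E =
                             \int[P]_(w in E `&` V @^-1` D) (k (j (V w)))%:E)%E.
Proof.
move=> mV' mr ms VE [mk iW ik Wk] E.
have mE : measurable E.
  by apply: measurable_preimage => //; exact: measurableT_comp.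
split.
  apply: eq_integrable (integrableS measurableT mE _ ik) => // w /set_mem Ew.
  by have [_ /= -> _] := VE w Ew.
move=> D mD.
have ED : E `&` V @^-1` D = V' @^-1` (s @^-1` [set z] `&` r @^-1` D).
  by apply/seteqP; split => w [/= Ew]; have [-> _ _] := VE w Ew; split.
have mD' : measurable (s @^-1` [set z] `&` r @^-1` D).
  by apply: measurableI; exact: measurable_preimage.
transitivity (\int[P]_(w in E `&` V @^-1` D) (W' w)%:E)%E.
  by apply: eq_integral => w /set_mem[/VE[_ _ ->]].
rewrite {1}ED Wk// -ED.
by apply: eq_integral => w /set_mem[/VE[_ /= -> _]].
Qed.

(** * Almost-everywhere statements on products, and conditioning through a joint density *)

Lemma ae_section {d1 d2} {T1 : measurableType d1} {T2 : measurableType d2}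
    {R : realType} (m1 : {sigma_finite_measure set T1 -> \bar R})
    (m2 : {sigma_finite_measure set T2 -> \bar R}) (A : set (T1 * T2)) :
  measurable A -> (m1 \x m2)%E A = 0%E ->
  {ae m2, forall y, m1 ((fun x => (x, y)) @^-1` A) = 0%E}.
Proof.
move=> mA A0.
have mAy y : measurable ((fun x => (x, y)) @^-1` A).
  by apply: measurable_preimage => //; exact: measurable_pair2.
have mI : measurable_fun setT (fun z => (\1_A z)%:E : \bar R).
  by apply/measurable_EFinP; exact: measurable_indic.
have GE y : fubini_G m1 (fun z => (\1_A z)%:E) y = m1 ((fun x => (x, y)) @^-1` A).
  by have := integral_indic m1 measurableT (mAy y); rewrite setIT.
have mG : measurable_fun setT (fun y => m1 ((fun x => (x, y)) @^-1` A)).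
  rewrite (_ : (fun _ => _) = fubini_G m1 (fun z => (\1_A z)%:E)).
    exact: measurable_fun_fubini_tonelli_G.
  by apply/funext => y; rewrite GE.
have : (\int[m2]_y `|m1 ((fun x => (x, y)) @^-1` A)| = 0)%E.
  under eq_integral do rewrite gee0_abs// -GE.
  rewrite -fubini_tonelli2// integral_indic//.
  by rewrite setIT.
move=> /(ae_eq_integral_abs m2 measurableT mG).
by apply: filterS => y /= /(_ I).
Qed.

Lemma ae_prod_fst {d1 d2} {T1 : measurableType d1} {T2 : measurableType d2}
    {R : realType} (m1 : {measure set T1 -> \bar R})
    (m2 : {sigma_finite_measure set T2 -> \bar R}) (Q : T1 -> Prop) :
  {ae m1, forall x, Q x} -> {ae (m1 \x m2)%E, forall z, Q z.1}.
Proof.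
move=> [N [mN N0 QN]]; exists (N `*` setT); split; first exact: measurableX.
- by rewrite product_measure1E// N0 mul0e.
- by move=> z Qz; split => //; exact: QN.
Qed.

Lemma ae_prod_snd {d1 d2} {T1 : measurableType d1} {T2 : measurableType d2}
    {R : realType} (m1 : {measure set T1 -> \bar R})
    (m2 : {sigma_finite_measure set T2 -> \bar R}) (Q : T2 -> Prop) :
  {ae m2, forall x, Q x} -> {ae (m1 \x m2)%E, forall z, Q z.2}.
Proof.
move=> [N [mN N0 QN]]; exists (setT `*` N); split; first exact: measurableX.
- by rewrite product_measure1E// N0 mule0.
- by move=> z Qz; split => //; exact: QN.
Qed.

(** This is Bayes' formula for [t], kept in multiplied form so that no division by a possibly zero
    marginal occurs. The residual [m - t] has zero mean on every event of [U]; expressed through the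
    density [f], this makes its [f]-weighted mean at fixed [u] vanish for almost every [u]. *)
Lemma cond_exp_joint_density {d dX dU} {Omega : measurableType d}
    {SX : measurableType dX} {SU : measurableType dU} {R : realType}
    (P : probability Omega R) (la : {sigma_finite_measure set SU -> \bar R})
    (X : Omega -> SX) (U : Omega -> SU) (f m : SX * SU -> R) (t : SU -> R) :
  measurable_fun setT X -> measurable_fun setT U ->
  measurable_fun setT f -> (forall z, 0 <= f z) ->
  (forall k : SX * SU -> \bar R, measurable_fun setT k -> (forall z, 0 <= k z)%E ->
    \int[P]_w k (X w, U w) =
    \int[P \x la]_z (k (X z.1, z.2) * (f (X z.1, z.2))%:E))%E ->
  measurable_fun setT m ->
  cond_exp_version P (fun w => m (X w, U w)) U t ->
  {ae la, forall u,
    (\int[P]_w (f (X w, u))%:E < +oo)%E /\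
    (\int[P]_w (m (X w, u) * f (X w, u))%:E =
     (t u)%:E * \int[P]_w (f (X w, u))%:E)%E}.
Proof.
move=> mX mU mf f0 JD mm [mt im it mtE].
have mXU : measurable_fun setT (fun z : Omega * SU => (X z.1, z.2)).
  by apply: measurable_fun_pair => //; exact: measurableT_comp.
have JDR (h : SX * SU -> R) : measurable_fun setT h ->
    P.-integrable setT (fun w => (h (X w, U w))%:E) ->
    (P \x la)%E.-integrable setT (fun z => (h (X z.1, z.2) * f (X z.1, z.2))%:E) /\
    (\int[P]_w (h (X w, U w))%:E =
     \int[P \x la]_z (h (X z.1, z.2) * f (X z.1, z.2))%:E)%E.
  move=> mh ih.
  have ih1 : P.-integrable setT (fun w => (h (X w, U w) * cst 1 w)%:E).
    by apply: eq_integrable ih => // w _; rewrite /= mulr1.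
  have := eq_integral_weighted (mu1 := P) (mu2 := (P \x la)%E) (w1 := cst 1)
    (w2 := fun z => f (X z.1, z.2)) (V1 := fun w => (X w, U w))
    (V2 := fun z => (X z.1, z.2)) _ _ _ mXU _ mh ih1.
  move=> /(_ _ _ _ _)/wrap[||||[i2 e2]] //.
  - exact: measurableT_comp.
  - move=> k mk k0; rewrite -JD//.
    by apply: eq_integral => w _; rewrite /= mule1.
  split => //; rewrite -e2.
  by apply: eq_integral => w _; rewrite /= mulr1.
pose k (z : SX * SU) := m z - t z.2.
have mk : measurable_fun setT k.
  by apply: measurable_funB => //; exact: measurableT_comp.
have ik : P.-integrable setT (fun w => (k (X w, U w))%:E).
  exact: (integrableB measurableT im it).
have [ikf _] := JDR k mk ik.
pose kf (z : Omega * SU) := (k (X z.1, z.2) * f (X z.1, z.2))%:E.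
pose G := fubini_G P kf.
have mG : measurable_fun setT G by exact: measurable_fubini_G ikf.
(* The integral of [G] over any measurable [B] is the expectation of the residual [k] on [U] in [B],
   which is zero. *)
have G0 : ae_eq la setT (cst 0%E) G.
  apply: integral_ae_eq => //; first exact: integrable0.
  move=> B _ mB; rewrite integral0 integral_indic_setT; apply/esym.
  have mkB : measurable_fun setT (fun z => k z * \1_B z.2).
    apply: measurable_funM => //.
    exact: (measurableT_comp (measurable_indic mB) measurable_snd).
  have mUB := measurable_preimage mU mB.
  have ikB : P.-integrable setT (fun w => (k (X w, U w) * \1_B (U w))%:E).
    exact: (@integrable_mul_indic _ _ _ P (U @^-1` B) (fun w => k (X w, U w))).
  have [ikBf kBfE] := JDR _ mkB ikB.
  transitivity (\int[la]_u \int[P]_w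
      (k (X w, u) * \1_B u * f (X w, u))%:E)%E.
    apply: eq_integral => u _; rewrite indicE; case: (u \in B).
      by rewrite mule1; apply: eq_integral => w _; rewrite mulr1.
    rewrite mule0 integral0_eq// => w _; by rewrite mulr0 mul0r.
  rewrite (integral21_prod_meas1 ikBf) -kBfE /=.
  under eq_integral do rewrite EFinM.
  rewrite -(integral_indic_setT P (U @^-1` B)).
  rewrite integralB_EFin//; [|exact: integrableS im|exact: integrableS it].
  rewrite mtE// subee//; apply: integrable_fin_num => //.
  exact: integrableS it.
(* The constant function 1 shows that [f] is integrable on the product, so its section at almost
   every [u] has finite integral. *)
have [i1f _] := JDR (cst 1) (measurable_cst _) 
  (finite_measure_integrable_cst P 1 measurableT).
have /ae_integrable2 if2 : (P \x la)%E.-integrable setT (fun z => (f (X z.1, z.2))%:E).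
  by apply: eq_integrable i1f => // z _; rewrite /= mul1r.
have /ae_integrable2 ikf2 := ikf.
move: G0 => /=; apply: filterS3 if2 ikf2 => u /= fu kfu /(_ I) Gu.
have fin : (\int[P]_w (f (X w, u))%:E)%E \is a fin_num by exact: integrable_fin_num.
split; first by rewrite ltey_eq fin.
transitivity (\int[P]_w ((k (X w, u) * f (X w, u))%:E +
                         (t u)%:E * (f (X w, u))%:E))%E.
  by apply: eq_integral => w _; rewrite -EFinM -EFinD -mulrDl subrK.
rewrite integralD//; last exact: integrableZl.
by rewrite [X in (X + _)%E](esym Gu) add0e integralZl.
Qed.

Section product_sigma_finite.
Context {d1 d2} {T1 : measurableType d1} {T2 : measurableType d2} {R : realType}.
Variable m1 : {sigma_finite_measure set T1 -> \bar R}.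
Variable m2 : {sigma_finite_measure set T2 -> \bar R}.

(* Instance search on [m1 \x m2] stops at the product of subprobabilities, so
   the sigma-finite structure is put on an alias. *)
Definition sigma_finite_product : set (T1 * T2) -> \bar R := (m1 \x m2)%E.

HB.instance Definition _ := Measure.copy sigma_finite_product (m1 \x m2)%E.

Let sigma_finite_productT : sigma_finite setT sigma_finite_product.
Proof.
have [F FT Foo] := sigma_finiteT m1; have [G GT Goo] := sigma_finiteT m2.
(* The rectangles built from the two covers are enumerated by coding pairs of indices; numbers that
   code no pair give the empty set. *)
exists (fun n => if unpickle n is Some (i, j) then F i `*` G j else set0).
  apply/seteqP; split => // -[x y] _.
  have [i _ Fx] : (\bigcup_i F i) x by rewrite -FT.
  have [j _ Gy] : (\bigcup_i G i) y by rewrite -GT.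
  by exists (pickle (i, j)) => //; rewrite pickleK.
move=> n; case: unpickle => [[i j]|]; last by rewrite measure0.
have [mF Fi] := Foo i; have [mG Gj] := Goo j.
split; first exact: measurableX.
by rewrite /sigma_finite_product product_measure1E// lte_mul_pinfty// ge0_fin_numE.
Qed.

HB.instance Definition _ := Measure_isSigmaFinite.Build _ _ _
  sigma_finite_product sigma_finite_productT.

End product_sigma_finite.

(** * Identification of densities, means and CDFs from the observed strata *)

(** Having equal integrals over the stratum, [fp] and [fz] agree almost everywhere there for the
    product measure. Taking sections at fixed [u] and then removing the stratum gives the claim;
    densities are only determined up to null sets, whence the exceptional set of [u]. *)
Lemma cond_density_stratum {d dX dW dU} {Omega : measurableType d}
    {SX : measurableType dX} {SW : measurableType dW} {SU : measurableType dU}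
    {R : realType} (P : probability Omega R)
    (la : {sigma_finite_measure set SU -> \bar R})
    (X : Omega -> SX) (W : Omega -> SW) (Z : Omega -> R) (M' : Omega -> SU)
    (z : R) (p : SX -> R) (a : SW -> SU)
    (fp fz : SX * SU -> R) (f' : SX * R * SU -> R) :
  measurable_fun setT X -> measurable_fun setT W -> measurable_fun setT Z ->
  measurable_fun setT M' -> measurable_fun setT a ->
  (forall w, Z w = z -> M' w = a (W w)) ->
  propensity P (Z @^-1` [set z]) X W p ->
  measurable_fun setT fp -> (forall v, 0 <= fp v) ->
  (forall A B, measurable A -> measurable B ->
    P (X @^-1` A `&` (a \o W) @^-1` B) =
    \int[P]_(w in X @^-1` A) \int[la]_(u in B) (fp (X w, u))%:E)%E ->
  measurable_fun setT f' -> (forall v, 0 <= f' v) ->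
  (forall A B, measurable A -> measurable B ->
    P ((fun w => (X w, Z w)) @^-1` A `&` M' @^-1` B) =
    \int[P]_(w in (fun w => (X w, Z w)) @^-1` A)
      \int[la]_(u in B) (f' (X w, Z w, u))%:E)%E ->
  (forall x u, f' (x, z, u) = fz (x, u)) ->
  {ae la, forall u, {ae P, forall w, fp (X w, u) = fz (X w, u)}}.
Proof.
move=> mX mW mZ mM' ma M'a pE mfp fp0 fpP mf' f'0 f'P f'fz.
have [mp p0 pk] := pE; set E := Z @^-1` [set z].
have mE : measurable E by exact: measurable_preimage.
have mfz : measurable_fun setT fz.
  rewrite (_ : fz = fun v => f' (v.1, z, v.2)); last first.
    by apply/funext => -[x u]; rewrite f'fz.
  apply: measurableT_comp => //; apply: measurable_fun_pair => //.
  by apply: measurable_fun_pair.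
have fz0 v : 0 <= fz v by case: v => x u; rewrite -f'fz.
have maW : measurable_fun setT (a \o W) by exact: measurableT_comp.
have mXZ : measurable_fun setT (fun w => (X w, Z w)) by exact: measurable_fun_pair.
pose V (v : Omega * SU) := (X v.1, v.2).
have mV : measurable_fun setT V.
  by apply: measurable_fun_pair => //; exact: measurableT_comp.
have mEU : measurable (E `*` [set: SU]) by exact: measurableX.
pose XM w := (X w, a (W w)).
have mXM : measurable_fun setT XM by exact: measurable_fun_pair.
(* Both densities integrate over [E `*` D] to [P (E `&` XM @^-1` D)]. *)
have fzE D : measurable D ->
    (\int[P \x la]_(v in E `*` setT `&` V @^-1` D) (fz (V v))%:E =
     P (E `&` XM @^-1` D))%E.
  move=> mD.
  (* Including the label [z] in the test set means that [f'] is evaluated only at [z], where it is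
     [fz]. *)
  pose D' : set (SX * R * SU) := [set v | v.1.2 = z /\ D (v.1.1, v.2)].
  have mD' : measurable D'.
    rewrite (_ : D' = (fun v => v.1.2) @^-1` [set z] `&`
                      (fun v => (v.1.1, v.2)) @^-1` D)//.
    apply: measurableI; apply: measurable_preimage => //.
      exact: (measurableT_comp measurable_snd measurable_fst).
    apply: measurable_fun_pair => //.
    exact: (measurableT_comp measurable_fst measurable_fst).
  have := ge0_integral_joint_density mXZ mM' mf' f'0 f'P
    (h := fun v => (\1_D' v)%:E).
  move=> /(_ _ _)/wrap[||JD] //.
    by apply/measurable_EFinP; exact: measurable_indic.
  rewrite integral_indic_setT.
  transitivity (\int[P]_w (\1_(E `&` XM @^-1` D) w)%:E)%E; last first.
    rewrite integral_indic ?setIT//; apply: measurableI => //.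
    exact: measurable_preimage.
  transitivity (\int[P]_w (\1_D' (X w, Z w, M' w))%:E)%E; last first.
    apply: eq_integral => w _; rewrite !indicE; congr ((_ : bool)%:R%:E).
    apply/idP/idP => /set_mem[Ew Dw]; apply/mem_set; split => //=.
      by rewrite /XM -M'a.
    by rewrite M'a.
  rewrite JD; apply: eq_integral => -[w u] _ /=; rewrite -!EFinM; congr (_%:E).
  rewrite mulrC !indicE; have [Ew|Ew] := eqVneq (Z w) z.
    rewrite Ew f'fz; congr ((_ : bool)%:R * _).
    by apply/idP/idP => /set_mem[? ?]; apply/mem_set; split => //=; split.
  have {}Ew : ~ Z w = z by exact/eqP.
  by rewrite !memNset ?mul0r//; first [by case=> /Ew|by case=> -[/Ew]].
have fpE D : measurable D ->
    (\int[P \x la]_(v in E `*` setT `&` V @^-1` D) (fp (V v))%:E =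
     P (E `&` XM @^-1` D))%E.
  move=> mD.
  (* The density [fp] lives on the whole space, so the stratum enters through the weight [p]. *)
  have := ge0_integral_joint_density mX maW mfp fp0 fpP
    (h := fun v => (\1_D v * p v.1)%:E).
  move=> /(_ _ _)/wrap[||JD].
  - apply/measurable_EFinP/measurable_funM; first exact: measurable_indic.
    exact: measurableT_comp.
  - by move=> v; rewrite lee_fin mulr_ge0// ltW.
  transitivity (\int[P]_w ((\1_D (XM w))%:E * (\1_E w)%:E))%E; last first.
    rewrite -integral_indic_setT (integral_indic P mE (measurable_preimage mXM mD)).
    by rewrite setIC.
  rewrite (pk (fun v => (\1_D (v.1, a v.2))%:E))//; last first.
    apply/measurable_EFinP; apply: (measurableT_comp (measurable_indic mD)).
    by apply: measurable_fun_pair => //; exact: measurableT_comp.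
  under [RHS]eq_integral do rewrite -EFinM.
  rewrite [RHS]JD integral_indic_setT.
  (* With the integral over [P] inside, the integrand at fixed [u] depends on [X] alone, and [p] can
     be exchanged back for the indicator of [E]. *)
  rewrite fubini_tonelli2; last 2 first.
  - apply: emeasurable_funM; apply/measurable_EFinP; first exact: measurableT_comp.
    by apply: measurable_indic; apply: measurableI => //; exact: measurable_preimage.
  - by move=> v; rewrite -EFinM lee_fin mulr_ge0.
  rewrite fubini_tonelli2; last 2 first.
  - rewrite /=; apply: emeasurable_funM; apply/measurable_EFinP; last first.
      exact: measurableT_comp.
    apply: measurable_funM; first exact: (measurableT_comp (measurable_indic mD)).
    exact: (measurableT_comp mp (measurableT_comp mX measurable_fst)).
  - by move=> v; rewrite -EFinM lee_fin !mulr_ge0// ltW.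
  apply: eq_integral => u _; rewrite /fubini_G/=.
  have := pk (fun v => (\1_D (v.1, u) * fp (v.1, u))%:E).
  move=> /(_ _ _)/wrap[||pku].
  - have m1 : measurable_fun setT (fun v : SX * SW => (v.1, u)).
      by apply: measurable_fun_pair.
    apply/measurable_EFinP/measurable_funM; last exact: measurableT_comp.
    exact: (measurableT_comp (measurable_indic mD)).
  - by move=> v; rewrite lee_fin mulr_ge0.
  rewrite /= in pku; transitivity (\int[P]_w
    ((\1_D (X w, u) * fp (X w, u))%:E * (\1_E w)%:E))%E.
    apply: eq_integral => w _; rewrite -!EFinM mulrAC mulrC; congr (_ * _)%:E.
    rewrite !indicE -natrM mulnb; congr ((_ : bool)%:R).
    apply/idP/andP => [/set_mem[[Ew _] Dw]|[/set_mem ? /set_mem ?]];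
      [by split; exact/mem_set|exact/mem_set].
  rewrite pku; apply: eq_integral => w _; rewrite -!EFinM; congr (_%:E).
  by rewrite mulrAC.
have int (f : SX * SU -> R) : measurable_fun setT f -> (forall v, 0 <= f v) ->
    (forall D, measurable D ->
      \int[P \x la]_(v in E `*` setT `&` V @^-1` D) (f (V v))%:E =
      P (E `&` XM @^-1` D))%E ->
    (P \x la)%E.-integrable (E `*` setT) (fun v => (f (V v))%:E).
  move=> mf f0 fE; apply/integrableP; split.
    by apply: measurable_funTS; apply/measurable_EFinP; exact: measurableT_comp.
  under eq_integral do rewrite gee0_abs ?lee_fin//.
  have := fE setT measurableT; rewrite !setIT => ->.
  exact: le_lt_trans (probability_le1 P mE) (ltry 1).
have := measure0_neq_preimage mEU mV mfp mfz (int _ mfp fp0 fpE) (int _ mfz fz0 fzE).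
move=> /(_ _)/wrap[D mD|]; first by rewrite fpE// fzE.
set N := [set v | _].
have mN : measurable N by exact: measurable_set_neq.
move/ae_section => /(_ _)/wrap[|].
  by apply: measurableI => //; exact: measurable_preimage.
apply: filterS => u EN0.
have mNu : measurable [set v : SX * SW | N (v.1, u)].
  by apply: (@measurable_preimage _ _ _ _ (fun v : SX * SW => (v.1, u))) => //;
    apply: measurable_fun_pair.
have XW_N0 : P ((fun w => (X w, W w)) @^-1` [set v | N (v.1, u)]) = 0%E.
  apply: (propensity_null mE mX mW pE mNu).
  rewrite -[RHS]EN0; congr (P _); apply/seteqP; split => w /=.
    by move=> [].
  by move=> [[]].
have mXW : measurable_fun setT (fun w => (X w, W w)) by exact: measurable_fun_pair.
move/(measure0_aeN (measurable_preimage mXW mNu)): XW_N0.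
by apply: filterS => w /= /negP; rewrite negbK => /eqP.
Qed.

(** On the stratum, [k] at label [z] has the integrals of [b (W w)] over all events of
    [(X, a (W w))]. The propensity transfer then compares it with [g] on the whole space. *)
Lemma mean_stratum {d dX dW} {Omega : measurableType d} {SX : measurableType dX}
    {SW : measurableType dW} {R : realType} (P : probability Omega R)
    (X : Omega -> SX) (W : Omega -> SW) (Z M' Y' : Omega -> R) (z : R)
    (p : SX -> R) (a b : SW -> R) (g : SX * R -> R) (k : SX * R * R -> R) :
  measurable_fun setT X -> measurable_fun setT W -> measurable_fun setT Z ->
  measurable_fun setT M' -> measurable_fun setT a -> measurable_fun setT b ->
  (forall w, Z w = z -> M' w = a (W w) /\ Y' w = b (W w)) ->
  propensity P (Z @^-1` [set z]) X W p ->
  cond_exp_version P (b \o W) (fun w => (X w, a (W w))) g ->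
  cond_exp_version P Y' (fun w => (X w, Z w, M' w)) k ->
  {ae P, forall w, g (X w, a (W w)) = k (X w, z, a (W w))}.
Proof.
move=> mX mW mZ mM' ma mb MY pE gP kP; have [mk _ _ _] := kP.
have mE : measurable (Z @^-1` [set z]) by exact: measurable_preimage.
have mj : measurable_fun setT (fun v : SX * R => (v.1, z, v.2)).
  by apply: measurable_fun_pair => //; exact: measurable_fun_pair.
have mXZM : measurable_fun setT (fun w => (X w, Z w, M' w)).
  by apply: measurable_fun_pair => //; exact: measurable_fun_pair.
have := @cond_exp_stratum _ _ _ _ _ _ _ P z _ (fun w => (X w, a (W w)))
  (fun v : SX * R * R => (v.1.1, v.2)) (fun v => v.1.2) (fun v => (v.1, z, v.2))
  Y' (b \o W) k mXZM.
move=> /(_ _ _ _ kP)/wrap[|||[ik kE]].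
- apply: measurable_fun_pair => //.
  exact: (measurableT_comp measurable_fst measurable_fst).
- exact: (measurableT_comp measurable_snd measurable_fst).
- by move=> w /= Zw; have [-> ->] := MY w Zw; rewrite Zw.
apply: (@propensity_cond_exp _ _ _ _ _ _ _ P _ X W p mE mX mW pE _ _
  (fun v => (v.1, a v.2)) fst (b \o snd) g (fun v => k (v.1, z, v.2))) => //.
- by apply: measurable_fun_pair => //; exact: measurableT_comp.
- exact: measurableT_comp.
- exact: measurableT_comp.
Qed.

(** At a fixed level [m] a conditional CDF is the conditional expectation of an indicator, so the
    argument for means applies and no level has to be excluded. *)
Lemma cdf_stratum {d dX dW} {Omega : measurableType d} {SX : measurableType dX}
    {SW : measurableType dW} {R : realType} (P : probability Omega R)
    (X : Omega -> SX) (W : Omega -> SW) (Z M' : Omega -> R) (z m : R)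
    (p : SX -> R) (a : SW -> R) (F : SX -> R -> R) (F' : SX * R -> R -> R) :
  measurable_fun setT X -> measurable_fun setT W -> measurable_fun setT Z ->
  measurable_fun setT a ->
  (forall w, Z w = z -> M' w = a (W w)) ->
  propensity P (Z @^-1` [set z]) X W p ->
  cond_cdf P (a \o W) X F -> cond_cdf P M' (fun w => (X w, Z w)) F' ->
  {ae P, forall w, F (X w) m = F' (X w, z) m}.
Proof.
move=> mX mW mZ ma M'a pE /(_ m) FP /(_ m) F'P; have [mF' _ _ _] := F'P.
have mE : measurable (Z @^-1` [set z]) by exact: measurable_preimage.
have mXZ : measurable_fun setT (fun w => (X w, Z w)) by exact: measurable_fun_pair.
have := @cond_exp_stratum _ _ _ _ _ _ _ P z _ X fst snd (fun x => (x, z))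
  _ (\1_((a \o W) @^-1` `]-oo, m])) _ mXZ measurable_fst measurable_snd.
move=> /(_ _ _ _ F'P)/wrap[|[iF' F'E]].
  move=> w /= Zw; split => //; first by rewrite Zw.
  rewrite !indicE; congr ((_ : bool)%:R).
  by apply/idP/idP => /set_mem /= h; apply/mem_set => /=; move: h; rewrite M'a.
apply: (@propensity_cond_exp _ _ _ _ _ _ _ P _ X W p mE mX mW pE _ _
  fst id (fun v => \1_`]-oo, m] (a v.2)) (F ^~ m) (fun x => F' (x, z) m)) => //.
- apply: (measurableT_comp (measurable_indic _)) => //.
  exact: measurableT_comp.
- exact: (measurableT_comp mF').
Qed.

(** * The tower property *)

(** Every event of [U] is an event of [(X, U)], so conditioning on the finer pair preserves
    integrals over it, also after an almost sure modification. *)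
Lemma cond_exp_ae_version {d dX dU} {Omega : measurableType d}
    {SX : measurableType dX} {SU : measurableType dU} {R : realType}
    (P : probability Omega R) (X : Omega -> SX) (U : Omega -> SU)
    (Y h : Omega -> R) (g : SX * SU -> R) :
  measurable_fun setT X -> measurable_fun setT U -> measurable_fun setT h ->
  cond_exp_version P Y (fun w => (X w, U w)) g ->
  {ae P, forall w, g (X w, U w) = h w} ->
  P.-integrable setT (EFin \o h) /\
  (forall B, measurable B ->
    \int[P]_(w in U @^-1` B) (h w)%:E = \int[P]_(w in U @^-1` B) (Y w)%:E)%E.
Proof.
move=> mX mU mh [mg iY ig Yg] gh; have ih := ae_eq_integrable mh gh ig.
split => // B mB; have mUB := measurable_preimage mU mB.
have -> : U @^-1` B = (fun w => (X w, U w)) @^-1` (setT `*` B).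
  by apply/seteqP; split => w //= -[].
rewrite Yg; last exact: measurableX.
have mXUB : measurable ((fun w => (X w, U w)) @^-1` (setT `*` B)).
  by apply: measurable_preimage; [exact: measurable_fun_pair|exact: measurableX].
apply: ae_eq_integral => //.
- by apply: measurable_funTS; exact/measurable_EFinP.
- by apply: measurable_funTS; exact: measurable_int ig.
- by apply: filterS gh => w /= ->.
Qed.

(** * Identification of the principal causal effect *)

Theorem theorem1
  (R : realType) (d : measure_display) (Omega : measurableType d)
  (P : probability Omega R)
  (dX : measure_display) (T : measurableType dX)
  (X : Omega -> T) (Z M1 M0 Y1 Y0 : Omega -> R)
  (mu1 mu0 : T -> R -> R) (tau : R -> R -> R)
  (c : R -> R -> R) (e : T -> R -> R -> R)
  (Fp1 Fp0 fp1 fp0 F1 F0 f1 f0 : T -> R -> R)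
  (* measurability of the random variables *)
  (mX : measurable_fun setT X) (mZ : measurable_fun setT Z)
  (mM1 : measurable_fun setT M1) (mM0 : measurable_fun setT M0)
  (mY1 : measurable_fun setT Y1) (mY0 : measurable_fun setT Y0)
  (* Z is binary *)
  (Zbin : forall w, Z w = 0 \/ Z w = 1)
  (* potential outcomes are integrable *)
  (iY1 : P.-integrable setT (EFin \o Y1))
  (iY0 : P.-integrable setT (EFin \o Y0))
  (* standing positivity: 0 < P(Z = 1 | X) < 1 a.s. *)
  (pos : forall A : set T, measurable A -> (0 < P (X @^-1` A))%E ->
     (0 < P (X @^-1` A `&` Z @^-1` [set 1%R]))%E /\
     (0 < P (X @^-1` A `&` Z @^-1` [set 0%R]))%E)
  (* mu_z(x,m) = E(Y | X = x, Z = z, M = m) *)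
  (hmu : cond_exp_version P (mix Z Y1 Y0)
           (fun w => (X w, Z w, mix Z M1 M0 w)) (fun p => zsel mu1 mu0 p.1 p.2))
  (* tau_u = E(Y_1 - Y_0 | U = u),  U = (M_1, M_0) *)
  (htau : cond_exp_version P (fun w => Y1 w - Y0 w)
            (fun w => (M1 w, M0 w)) (fun u => tau u.1 u.2))
  (* (A1) Z independent of (M_0, M_1, Y_0, Y_1) given X *)
  (A1 : cond_indep P Z (fun w => ((M0 w, M1 w), (Y0 w, Y1 w))) X)
  (* (A2) E(Y_z | X, U = u) = E(Y_z | X, M_z = m_z) *)
  (A2 : (exists g : T -> R -> R,
           cond_exp_version P Y1 (fun w => (X w, M1 w)) (fun p => g p.1 p.2) /\
           cond_exp_version P Y1 (fun w => (X w, (M1 w, M0 w)))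
             (fun p => g p.1 p.2.1)) /\
        (exists g : T -> R -> R,
           cond_exp_version P Y0 (fun w => (X w, M0 w)) (fun p => g p.1 p.2) /\
           cond_exp_version P Y0 (fun w => (X w, (M1 w, M0 w)))
             (fun p => g p.1 p.2.2))) :
  (* first claim: tau_U = E{ mu_1(X, M_1) - mu_0(X, M_0) | U } *)
  cond_exp_version P (fun w => mu1 (X w) (M1 w) - mu0 (X w) (M0 w))
    (fun w => (M1 w, M0 w)) (fun u => tau u.1 u.2) /\
  (* second claim, under (A3) *)
  (copula_density c ->
   (* e_u(x) = f(U = u | X = x) *)
   cond_density2 P M1 M0 X e ->
   (* F(M_z = . | X = x), f(M_z = . | X = x) *)
   cond_cdf P M1 X Fp1 -> cond_cdf P M0 X Fp0 ->
   cond_density P M1 X fp1 -> cond_density P M0 X fp0 ->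
   (* F_{zm}(x) = P(M <= m | X = x, Z = z), f_{zm}(x) = f(M = m | X = x, Z = z) *)
   cond_cdf P (mix Z M1 M0) (fun w => (X w, Z w)) (zsel F1 F0) ->
   cond_density P (mix Z M1 M0) (fun w => (X w, Z w)) (zsel f1 f0) ->
   (* (A3) *)
   (forall x m1 m0, e x m1 m0 = c (Fp1 x m1) (Fp0 x m0) * (fp1 x m1 * fp0 x m0)) ->
   {ae (lebesgue_measure \x lebesgue_measure)%E, forall u : R * R,
     (* e_u = E{e_u(X)} > 0 *)
     (0 < \int[P]_w (e (X w) u.1 u.2)%:E)%E ->
     (tau u.1 u.2)%:E =
       (\int[P]_w ((mu1 (X w) u.1 - mu0 (X w) u.2) *
                    (c (F1 (X w) u.1) (F0 (X w) u.2) * (f1 (X w) u.1 * f0 (X w) u.2)))%:E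
        * (\int[P]_w (e (X w) u.1 u.2)%:E)^-1)%E /\
     {ae P, forall w, e (X w) u.1 u.2 =
        c (F1 (X w) u.1) (F0 (X w) u.2) * (f1 (X w) u.1 * f0 (X w) u.2)}}).
Proof.
pose W w := ((M0 w, M1 w), (Y0 w, Y1 w)).
pose U w := (M1 w, M0 w).
have mW : measurable_fun setT W by do 2 apply: measurable_fun_pair => //.
have mU : measurable_fun setT U by exact: measurable_fun_pair.
have mM : measurable_fun setT (mix Z M1 M0).
  apply: measurable_funD; apply: measurable_funM => //.
  exact: measurable_funB.
have mixl A B w : Z w = 1 -> mix Z A B w = A w.
  by rewrite /mix => ->; rewrite mul1r subrr mul0r addr0.
have mixr A B w : Z w = 0 -> mix Z A B w = B w.
  by rewrite /mix => ->; rewrite mul0r add0r subr0 mul1r.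
have sel1 (h1 h0 : T -> R -> R) x : zsel h1 h0 (x, 1) = h1 x.
  by apply/funext => m; rewrite /zsel eqxx.
have sel0 (h1 h0 : T -> R -> R) x : zsel h1 h0 (x, 0) = h0 x.
  by apply/funext => m; rewrite /zsel eq_sym oner_eq0.
have [p1 p1P] := propensity_exists mX mW mZ (measurable_set1 1) A1
  (fun A mA h => (pos A mA h).1).
have [p0 p0P] := propensity_exists mX mW mZ (measurable_set1 0) A1
  (fun A mA h => (pos A mA h).2).
(* [W] lists [M0] before [M1], so the treated value is the second component. *)
pose a1 (v : (R * R) * (R * R)) := v.1.2.
pose a0 (v : (R * R) * (R * R)) := v.1.1.
have ma1 : measurable_fun setT a1 by exact: (measurableT_comp measurable_snd).
have ma0 : measurable_fun setT a0 by exact: (measurableT_comp measurable_fst).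
have sec (h1 h0 : T -> R -> R) z :
    measurable_fun setT (fun v : T * R * R => zsel h1 h0 v.1 v.2) ->
    measurable_fun setT (fun v : T * R => zsel h1 h0 (v.1, z) v.2).
  move=> mh; have mj : measurable_fun setT (fun v : T * R => (v.1, z, v.2)).
    by apply: measurable_fun_pair => //; exact: measurable_fun_pair.
  exact: (measurableT_comp mh mj).
have [mmu _ _ _] := hmu.
have mmu1 : measurable_fun setT (fun v : T * R => mu1 v.1 v.2).
  by under eq_fun do rewrite -(sel1 mu1 mu0); exact: sec.
have mmu0 : measurable_fun setT (fun v : T * R => mu0 v.1 v.2).
  by under eq_fun do rewrite -(sel0 mu1 mu0); exact: sec.
have [[g1 [g1M g1U]] [g0 [g0M g0U]]] := A2.
have gmu1 : {ae P, forall w, g1 (X w) (M1 w) = mu1 (X w) (M1 w)}.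
  have := mean_stratum (z := 1) (a := a1) (b := fun v => v.2.2)
    mX mW mZ mM ma1 _ _ p1P g1M hmu.
  move=> /(_ _ _)/wrap[||].
  - exact: (measurableT_comp measurable_snd measurable_snd).
  - by move=> w Zw; rewrite !mixl.
  - by apply: filterS => w /= ->; rewrite sel1.
have gmu0 : {ae P, forall w, g0 (X w) (M0 w) = mu0 (X w) (M0 w)}.
  have := mean_stratum (z := 0) (a := a0) (b := fun v => v.2.1)
    mX mW mZ mM ma0 _ _ p0P g0M hmu.
  move=> /(_ _ _)/wrap[||].
  - exact: (measurableT_comp measurable_fst measurable_snd).
  - by move=> w Zw; rewrite !mixr.
  - by apply: filterS => w /= ->; rewrite sel0.
have mmu1X : measurable_fun setT (fun w => mu1 (X w) (M1 w)).
  exact: (measurableT_comp mmu1 (measurable_fun_pair mX mM1)).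
have mmu0X : measurable_fun setT (fun w => mu0 (X w) (M0 w)).
  exact: (measurableT_comp mmu0 (measurable_fun_pair mX mM0)).
(* By (A2) the same [g1], just identified with [mu1] at [(X, M1)], is also a version given [(X, U)];
   averaging down to [U] puts [mu1] in place of [Y1]. *)
have [imu1 mu1E] := cond_exp_ae_version mX mU mmu1X g1U gmu1.
have [imu0 mu0E] := cond_exp_ae_version mX mU mmu0X g0U gmu0.
have claim1 : cond_exp_version P (fun w => mu1 (X w) (M1 w) - mu0 (X w) (M0 w))
    (fun w => (M1 w, M0 w)) (fun u => tau u.1 u.2).
  have [mtau _ itau tauE] := htau; split => //.
    exact: (integrableB measurableT imu1 imu0).
  move=> B mB; rewrite -tauE//; have mUB := measurable_preimage mU mB.
  rewrite integralB_EFin//; [|exact: integrableS imu1|exact: integrableS imu0].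
  rewrite [RHS]integralB_EFin//; [|exact: integrableS iY1|exact: integrableS iY0].
  by rewrite mu1E// mu0E.
split; first exact: claim1.
move=> [mc _ _ _] [me e0 eP] Fp1P Fp0P [mfp1 fp1_0 fp1P] [mfp0 fp0_0 fp0P]
  FP [mf f_0 fP] A3.
have F1E m : {ae P, forall w, Fp1 (X w) m = F1 (X w) m}.
  have := cdf_stratum m mX mW mZ ma1 _ p1P Fp1P FP.
  move=> /(_ _)/wrap[|]; first by move=> w Zw; rewrite mixl.
  by apply: filterS => w /= ->; rewrite sel1.
have F0E m : {ae P, forall w, Fp0 (X w) m = F0 (X w) m}.
  have := cdf_stratum m mX mW mZ ma0 _ p0P Fp0P FP.
  move=> /(_ _)/wrap[|]; first by move=> w Zw; rewrite mixr.
  by apply: filterS => w /= ->; rewrite sel0.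
have f1E : {ae lebesgue_measure, forall m : R,
    {ae P, forall w, fp1 (X w) m = f1 (X w) m}}.
  apply: (@cond_density_stratum _ _ _ _ _ _ _ _ _ P lebesgue_measure X W Z _ 1
    p1 a1 (fun v => fp1 v.1 v.2) (fun v => f1 v.1 v.2) (fun v => zsel f1 f0 v.1 v.2)
    mX mW mZ mM ma1 _ p1P mfp1 _ fp1P mf _ fP) => //.
  - by move=> w Zw; rewrite mixl.
  - by move=> x m /=; rewrite sel1.
have f0E : {ae lebesgue_measure, forall m : R,
    {ae P, forall w, fp0 (X w) m = f0 (X w) m}}.
  apply: (@cond_density_stratum _ _ _ _ _ _ _ _ _ P lebesgue_measure X W Z _ 0
    p0 a0 (fun v => fp0 v.1 v.2) (fun v => f0 v.1 v.2) (fun v => zsel f1 f0 v.1 v.2)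
    mX mW mZ mM ma0 _ p0P mfp0 _ fp0P mf _ fP) => //.
  - by move=> w Zw; rewrite mixr.
  - by move=> x m /=; rewrite sel0.
pose la2 := [the {sigma_finite_measure
  set (measurableTypeR R * measurableTypeR R)%type -> \bar R} of
  sigma_finite_product (@lebesgue_measure R) (@lebesgue_measure R)].
(* Tonelli turns the iterated integrals in the definition of [e] into an integral over the plane. *)
have joint (k : T * (R * R) -> \bar R) :
    measurable_fun setT k -> (forall z, 0 <= k z)%E ->
    (\int[P]_w k (X w, U w) =
     \int[P \x la2]_z (k (X z.1, z.2) * (e (X z.1) z.2.1 z.2.2)%:E))%E.
  move=> mk k0.
  have := @ge0_integral_joint_density _ _ _ _ _ _ _ P
    la2 X U
    (fun v => e v.1 v.2.1 v.2.2) k mX mU me.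
  apply => //.
  move=> A B mA mB; rewrite eP//; apply: eq_integral => w _ /=.
  rewrite [RHS]integral_indic_setT fubini_tonelli1.
  - apply: eq_integral => m1 _; apply: eq_integral => m0 _.
    by rewrite /= -EFinM mulrC.
  - apply: emeasurable_funM; apply/measurable_EFinP; last exact: measurable_indic.
    exact: (measurableT_comp me (measurable_pair1 (X w))).
  - by move=> u; rewrite -EFinM lee_fin mulr_ge0.
have := @cond_exp_joint_density _ _ _ _ _ _ _ P la2 X U
  (fun v => e v.1 v.2.1 v.2.2) (fun v => mu1 v.1 v.2.1 - mu0 v.1 v.2.2)
  (fun u => tau u.1 u.2) mX mU me _ joint _ claim1.
move=> /(_ _ _)/wrap[//||tauE].
  have mpr1 : measurable_fun setT (fun v : T * (R * R) => (v.1, v.2.1)).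
    apply: measurable_fun_pair => //.
    exact: (measurableT_comp measurable_fst measurable_snd).
  have mpr0 : measurable_fun setT (fun v : T * (R * R) => (v.1, v.2.2)).
    apply: measurable_fun_pair => //.
    exact: (measurableT_comp measurable_snd measurable_snd).
  apply: measurable_funB.
    exact: (measurableT_comp mmu1 mpr1).
  exact: (measurableT_comp mmu0 mpr0).
(* The exceptional sets of [m1] and of [m0] are null on the line, hence the corresponding strips are
   null in the plane. *)
have := ae_prod_fst lebesgue_measure f1E; have := ae_prod_snd lebesgue_measure f0E.
move: tauE; apply: filterS3 => -[m1 m0] /= [eoo tauE] f0E' f1E' e_gt0.
have eE : {ae P, forall w, e (X w) m1 m0 =
    c (F1 (X w) m1) (F0 (X w) m0) * (f1 (X w) m1 * f0 (X w) m0)}.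
  have FE : {ae P, forall w, Fp1 (X w) m1 = F1 (X w) m1 /\
                             Fp0 (X w) m0 = F0 (X w) m0}.
    by apply: filterS2 (F1E m1) (F0E m0).
  by apply: filterS3 FE f1E' f0E' => w [F1w F0w] f1w f0w; rewrite A3 F1w F0w f1w f0w.
split => //.
have -> : (\int[P]_w ((mu1 (X w) m1 - mu0 (X w) m0) *
    (c (F1 (X w) m1) (F0 (X w) m0) * (f1 (X w) m1 * f0 (X w) m0)))%:E =
    \int[P]_w ((mu1 (X w) m1 - mu0 (X w) m0) * e (X w) m1 m0)%:E)%E.
  have mat (h : T * R -> R) m : measurable_fun setT h ->
      measurable_fun setT (fun w => h (X w, m)).
    move=> mh; apply: (measurableT_comp mh).
    exact: (measurable_fun_pair mX (measurable_cst m)).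
  have mdmu : measurable_fun setT (fun w => mu1 (X w) m1 - mu0 (X w) m0).
    by apply: measurable_funB; [exact: (mat _ m1 mmu1)|exact: (mat _ m0 mmu0)].
  apply: ae_eq_integral => //.
  - apply/measurable_EFinP/measurable_funM => //.
    apply: measurable_funM; last first.
      have msel z : measurable_fun setT (fun v : T * R => zsel f1 f0 (v.1, z) v.2).
        exact: sec.
      apply: measurable_funM.
        have := mat _ m1 (msel 1); rewrite /=; under eq_fun do rewrite sel1.
        exact.
      have := mat _ m0 (msel 0); rewrite /=; under eq_fun do rewrite sel0.
      exact.
    have [mF1 _ _ _] := FP m1; have [mF0 _ _ _] := FP m0.
    have mF1X : measurable_fun setT (fun w => F1 (X w) m1).
      have := measurableT_comp mF1 (measurable_fun_pair mX (measurable_cst (1 : R))).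
      by rewrite /comp; under eq_fun do rewrite sel1.
    have mF0X : measurable_fun setT (fun w => F0 (X w) m0).
      have := measurableT_comp mF0 (measurable_fun_pair mX (measurable_cst (0 : R))).
      by rewrite /comp; under eq_fun do rewrite sel0.
    exact: (measurableT_comp mc (measurable_fun_pair mF1X mF0X)).
  - apply/measurable_EFinP/measurable_funM => //.
    exact: (measurableT_comp me (measurable_fun_pair mX (measurable_cst (m1, m0)))).
  - by apply: filterS eE => w /= ->.
rewrite tauE; move: e_gt0 eoo.
(* The marginal density at [u] is positive and finite, so both infinite cases are excluded and the
   extended division is an ordinary one. *)
case: (integral _ _ _) => [r||]// r_gt0 _.
have r_neq0 : r != 0 by rewrite gt_eqF// -lte_fin.
by rewrite inver (negPf r_neq0) -!EFinM mulfK.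
Qed.
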